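(* Let $A$ be a totally ordered finite alphabet and let $w\in A^*$ be a primitive word. The following conditions are equivalent: (i) $w$ is a perfectly clustering Lyndon word; (ii) $w$ is a product of two palindromes, and $w$ has a palindromic special factorization; (iii) $w$ has a special factorization $w=a_1\pi_1a_2\pi_2\cdots\pi_{k-1}a_k$ such that $w$ is conjugate to $W=a_k\pi_{k-1}a_{k-1}\cdots a_2\pi_1a_1$.
   Context: For $w\in A^*$, $Alph(w)$ is the set of letters occurring in $w$. A special factorization of $w$ is a factorization $w=a_1\pi_1a_2\pi_2\cdots\pi_{k-1}a_k$ where $Alph(w)=\{a_1<a_2<\cdots<a_k\}$ and $\pi_1,\dots,\pi_{k-1}\in A^*$ are arbitrary words. Given such a factorization, $W:=a_k\pi_{k-1}a_{k-1}\cdots\pi_2a_2\pi_1a_1$. The special factorization is palindromic if each $\pi_i$ is a palindrome (equal to its reversal). Two words $u,v$ are conjugate if $u=xy$, $v=yx$ for some words $x,y$. Words are compared in lexicographic order (a proper prefix is smaller). A Lyndon word is a primitive word strictly smaller than all its other conjugates. For a primitive word $v$ of length $n$ with conjugates $v_1<v_2<\cdots<v_n$, its Burrows–Wheeler transform is $\mathrm{bw}(v)=l_1\cdots l_n$, where $l_i$ is the last letter of $v_i$. A primitive word $v$ is perfectly clustering if $\mathrm{bw}(v)$ is weakly decreasing, i.e. $\mathrm{bw}(v)=b_k^{|v|_{b_k}}\cdots b_1^{|v|_{b_1}}$ where $b_1<\cdots<b_k$ are the letters of the alphabet and $|v|_b$ is the number of occurrences of $b$ in $v$. *)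

(* Defs.v *)
From HB Require Import structures.
From mathcomp Require Import all_boot all_order.
Set Implicit Arguments. Unset Strict Implicit. Unset Printing Implicit Defensive.
Import Order.TTheory.
Local Open Scope order_scope.

Section Words.
Context {d : Order.disp_t} {A : finOrderType d}.

Fixpoint lex_lt (u v : seq A) : bool :=
  match u, v with
  | [::], [::] => false
  | [::], _ :: _ => true
  | _ :: _, [::] => false
  | x :: u', y :: v' => (x < y) || ((x == y) && lex_lt u' v')
  end.

Definition lex_le (u v : seq A) : bool := (u == v) || lex_lt u v.

Definition primitive (w : seq A) : Prop :=
  w != [::] /\ forall (u : seq A) (k : nat), w = flatten (nseq k u) -> k = 1%N.

Definition conjugate (u v : seq A) : Prop :=
  exists x y : seq A, u = x ++ y /\ v = y ++ x.

Definition palindrome (p : seq A) : Prop := rev p = p.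

Definition lyndon (w : seq A) : Prop :=
  primitive w /\ forall i, (0 < i < size w)%N -> lex_lt w (rot i w).

Definition conjugates (v : seq A) : seq (seq A) :=
  [seq rot i v | i <- iota 0 (size v)].

Definition bw (v : seq A) : seq A :=
  match v with
  | [::] => [::]
  | x :: _ => map (last x) (sort lex_le (conjugates v))
  end.

Definition perfectly_clustering (v : seq A) : Prop :=
  primitive v /\ sorted (fun a b : A => b <= a) (bw v).

Fixpoint weave (al : seq A) (ps : seq (seq A)) : seq A :=
  match al, ps with
  | [::], _ => [::]
  | a :: _, [::] => [:: a]
  | a :: al', p :: ps' => a :: p ++ weave al' ps'
  end.

Definition special_factorization (w : seq A) (al : seq A) (ps : seq (seq A)) : Prop :=
  [/\ sorted (fun a b : A => a < b) al, al =i w,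
      size ps = (size al).-1 & w = weave al ps].

Definition special_W (al : seq A) (ps : seq (seq A)) : seq A :=
  weave (rev al) (rev ps).

End Words.

(* Main.v *)
Require Import Defs.
From mathcomp Require Import all_boot all_order.
From mathcomp Require Import zify.
Set Implicit Arguments. Unset Strict Implicit. Unset Printing Implicit Defensive.
Import Order.TTheory.

(* (iii) => (i): a cut of [w] just after the first letter of a factor
   [a_j pi_j a_(j+1)], or further inside it, is paired with the cut of [W] at
   the same place of [a_(j+1) pi_j a_j]. The conjugate of [w] is the larger of
   the two, since both read the rest of [pi_j] and then [a_(j+1)], resp. [a_j];
   and its last letter is not larger. Every conjugate but [W] is the smaller
   member of exactly one pair and every conjugate but [w] the larger member of
   exactly one, so the pairs are the consecutive conjugates in lexicographic
   order: [w] is the least one and the Burrows-Wheeler transform decreases.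

   (ii) => (iii): [W] is the reversal of [w], which is conjugate to [w].

   (i) => (ii): on the ranks of the sorted conjugates, the shift [T] is a
   discrete interval exchange reversing the order of its intervals, and a
   single cycle. Let [R] be the reversal of the ranks; [S = R T] reverses each
   interval, so [T^-1 = R T R]. Two neighbouring ranks move in parallel under
   [T] until they are separated by an end of an interval. The orbit of 0 meets
   the first points [f_1, ..., f_k] of the intervals in this order, with
   palindromes in between: this holds for the segment ending in [f_j] as soon
   as it carries a pair of neighbours exchanged by [R] or by [S]. Such a pair
   is unique in its segment, and there are at least [k - 1] of them, because
   [R] and each of the [k] pieces of [S] fix a point or exchange two
   neighbours, while as reflections of an orbit of length [N] they have only
   two fixed points in all. *)

(** * Pairings of consecutive elements in a sorted list *)

(** The least element of [L] is no second component, hence is [m]. Deleting it along with its pair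
    [(m, v)] makes [v] the missing second component for the tail, so by induction [v] comes next in
    [L]. *)
Lemma sorted_matching (T : eqType) (lt r : rel T) (L : seq T) (M m : T)
    (ps : seq (T * T)) :
  irreflexive lt -> transitive lt -> sorted lt L ->
  perm_eq (M :: unzip1 ps) L -> perm_eq (m :: unzip2 ps) L ->
  all (fun p => lt p.1 p.2 && r p.1 p.2) ps ->
  sorted r L /\ head m L = m.
Proof.
move=> ltxx ltT; elim: L M m ps => [|x L IH] M m ps //=.
rewrite (path_sortedE ltT) => /andP[/allP xL sL] p1 p2 aps.
have in1 u : u \in unzip1 ps -> u \in x :: L.
  by move=> h; rewrite -(perm_mem p1) inE h orbT.
have min_x : x \notin unzip2 ps.
  apply/negP => /mapP[[u v] pin /= xv]; have /andP[/= ltuv _] := allP aps _ pin.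
  have := in1 u (map_f fst pin); rewrite inE => /orP[/eqP ux|/xL xu].
    by move: ltuv; rewrite ux -xv ltxx.
  by have := ltT _ _ _ xu ltuv; rewrite -xv ltxx.
have mx : x = m.
  have : x \in m :: unzip2 ps by rewrite (perm_mem p2) mem_head.
  by rewrite inE (negbTE min_x) orbF => /eqP.
split=> //; rewrite -{}mx perm_cons in p2 *.
case: L IH xL sL p1 in1 p2 => [|y L] //= IH xL sL p1 in1 p2.
have yL u : u \in y :: L -> ~~ lt u y.
  rewrite inE => /orP[/eqP->|uL]; first by rewrite ltxx.
  move: sL; rewrite (path_sortedE ltT) => /andP[/allP yL _].
  by apply/negP => /(ltT _ _ _ (yL u uL)); rewrite ltxx.
have : x \in M :: unzip1 ps by rewrite (perm_mem p1) mem_head.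
rewrite inE => /orP[/eqP xM|/mapP[[u v] pin /= xu]].
  have : y \in unzip2 ps by rewrite (perm_mem p2) mem_head.
  case/mapP => [[u v] pin /= yv]; have /andP[/= ltuv _] := allP aps _ pin.
  move: p1; rewrite -xM perm_cons => /perm_mem p1.
  have uL : u \in y :: L by rewrite -p1 (map_f fst pin).
  by have := yL u uL; rewrite yv ltuv.
have pp := perm_to_rem pin.
have q1 : perm_eq (M :: unzip1 (rem (u, v) ps)) (y :: L).
  rewrite -(perm_cons x) -(permPr p1) (permPr (_ : perm_eq _ (M :: map fst ((u, v) :: rem (u, v) ps)))).
    by rewrite xu /= -!/(unzip1 _); apply/permP => a /=; lia.
  by rewrite perm_cons perm_map.
have q2 : perm_eq (v :: unzip2 (rem (u, v) ps)) (y :: L).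
  by rewrite -(permPr p2) -/(map snd ((u, v) :: _)) perm_sym perm_map.
have aps' : all (fun p => lt p.1 p.2 && r p.1 p.2) (rem (u, v) ps).
  by apply/allP => p /mem_rem pin'; exact: (allP aps).
have [/= -> ->] := IH M v _ sL q1 q2 aps'.
by have /andP[_ /=] := allP aps _ pin; rewrite -xu => ->.
Qed.

(** * The lexicographic order *)

Section LexicographicOrder.
Context {d : Order.disp_t} {A : finOrderType d}.
Implicit Types (a b : A) (u v w : seq A).

Lemma lex_ltxx : irreflexive (@lex_lt d A).
Proof. by elim=> //= x u ->; rewrite ltxx eqxx. Qed.

Lemma lex_lt_trans : transitive (@lex_lt d A).
Proof.
elim=> [|y v IH] [|x u] [|z w] //= /orP[xy|/andP[/eqP-> uv]].
  by move=> /orP[yz|/andP[/eqP<- _]]; rewrite ?xy ?(lt_trans xy yz).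
by move=> /orP[->|/andP[/eqP-> /(IH _ _ uv) ->]] //; rewrite eqxx orbT.
Qed.

Lemma lex_lt_total u v : u != v -> lex_lt u v || lex_lt v u.
Proof.
elim: u v => [|x u IH] [|y v] //=; case: (ltgtP x y) => //= ->.
by rewrite eqseq_cons eqxx /= => /IH.
Qed.

Lemma lex_le_total : total (@lex_le d A).
Proof.
move=> u v; rewrite /lex_le; case: (eqVneq u v) => //= uv.
by case/orP: (lex_lt_total uv) => ->; rewrite ?orbT.
Qed.

Lemma lex_lt_cat2l s u v : lex_lt (s ++ u) (s ++ v) = lex_lt u v.
Proof. by elim: s => //= x s ->; rewrite ltxx eqxx. Qed.

Lemma lex_lt_cat u v s t : size u = size v -> lex_lt u v -> lex_lt (u ++ s) (v ++ t).
Proof.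
elim: u v => [|x u IH] [|y v] //= [suv] /orP[->//|/andP[-> uv]].
by rewrite IH // orbT.
Qed.

(** This makes the shift increasing on ranks of conjugates with the same first letter. *)
Lemma lex_lt_rot1 a u v : size u = size v ->
  lex_lt (a :: u) (a :: v) -> lex_lt (rot 1 (a :: u)) (rot 1 (a :: v)).
Proof.
by move=> suv /=; rewrite ltxx eqxx /= !rot1_cons -!cats1; apply: lex_lt_cat.
Qed.

End LexicographicOrder.

(** * Conjugates of a primitive word *)

Section Conjugates.
Context {d : Order.disp_t} {A : finOrderType d}.
Implicit Types (w : seq A).

Lemma rot_iter_rot1 m w : m <= size w -> rot m w = iter m (rot 1) w.
Proof. by elim: m => [|m IH] h /=; rewrite ?rot0 // rotS // IH // ltnW. Qed.

(* [rot] saturates at the length, so the index is reduced modulo it. *)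
Lemma iter_rot1 m w : iter m (rot 1) w = rot (m %% size w) w.
Proof.
case: (posnP (size w)) => [/size0nil ->|w0].
  by rewrite modn0 rot_oversize //; elim: m => //= m ->.
have per k : iter (k * size w) (rot 1) w = w.
  by elim: k => //= k IH; rewrite mulSn iterD IH -rot_iter_rot1 // rot_size.
rewrite {1}(divn_eq m (size w)) addnC iterD per rot_iter_rot1 //.
by rewrite ltnW ?ltn_mod.
Qed.

(** Two equal rotations give a rotation by [0 < k < size w] that fixes [w]. By Bezout the rotation
    by the gcd [g] of [k] and [size w] fixes [w] too, and [w] is a proper power of its prefix of
    length [g]. *)
Lemma primitive_conjugates_uniq w : primitive w -> uniq (conjugates w).
Proof.
case=> wn0 pw; rewrite map_inj_in_uniq ?iota_uniq // => i j.
rewrite !mem_iota !add0n /=.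
wlog lt_ij : i j / i < j.
  move=> H hi hj e; case: (ltngtP i j) => // lt_ij; first exact: H.
  by apply/esym/H.
move=> hi hj e.
have {e} : rot (j - i) w = w.
  rewrite -[in RHS](rotK i w) -[rot (j - i) w](rotK i) rot_rot; congr (rotr i _).
  by rewrite -rotD subnK ?(ltnW lt_ij) // ltnW.
set k := (j - i)%N => ek.
have k0 : 0 < k by rewrite /k; lia.
have kw : k < size w by rewrite /k; lia.
have {lt_ij hi hj} : exists g, [/\ 0 < g, g < size w, g %| size w & rot g w = w].
  exists (gcdn k (size w)); split.
  - by rewrite gcdn_gt0 k0.
  - by rewrite (leq_ltn_trans _ kw) // dvdn_leq ?dvdn_gcdl.
  - exact: dvdn_gcdr.
  have [a b E _] := egcdnP (size w) k0.
  have ik : iter k (rot 1) w = w by rewrite -rot_iter_rot1 1?ltnW.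
  have ia : iter (a * k) (rot 1) w = w.
    by elim: (a) => //= c IH; rewrite mulSn iterD IH.
  rewrite E in ia; rewrite -[RHS]ia iter_rot1 -modnDml modnMl add0n -iter_rot1.
  rewrite rot_iter_rot1 //.
  by rewrite (leq_trans _ (ltnW kw)) // dvdn_leq ?dvdn_gcdl.
case=> g [g0 gw /dvdnP[q sw] rg].
have per c : c * g <= size w -> take (c * g) w = flatten (nseq c (take g w)).
  elim: c => [|c IH] h; first by rewrite take0.
  rewrite mulSn takeD /= -IH; last by rewrite (leq_trans _ h) // leq_mul2r leqnSn orbT.
  congr (_ ++ _); rewrite -{2}rg /rot takel_cat ?size_drop //.
  by move: h; rewrite mulSn; lia.
have /pw q1 : w = flatten (nseq q (take g w)).
  by rewrite -per -sw // take_size.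
by move: gw; rewrite sw q1 mul1n ltnn.
Qed.

Lemma size_conjugates w : size (conjugates w) = size w.
Proof. by rewrite size_map size_iota. Qed.

Lemma map_last_conjugates x w : perm_eq (map (last x) (conjugates w)) w.
Proof.
case/lastP: w => [|s y] //; set w := rcons s y.
have -> : map (last x) (conjugates w) = rotr 1 w.
  apply: (@eq_from_nth _ x); rewrite ?size_map ?size_iota ?size_rotr // => i hi.
  have hi' : i < size w by [].
  rewrite -map_comp (nth_map 0) ?size_iota // nth_iota //= add0n.
  case: i hi hi' => [|i] _ hi.
    by rewrite rot0 rotr1_rcons last_rcons.
  rewrite rotr1_rcons /= /rot last_cat (take_nth x) 1?ltnW // last_rcons.
  by rewrite /w nth_rcons; move: hi; rewrite size_rcons ltnS => ->.
by rewrite perm_rot perm_refl.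
Qed.

Lemma map_head_conjugates x w : map (head x) (conjugates w) = w.
Proof.
apply: (@eq_from_nth _ x); rewrite ?size_map ?size_iota // => i hi.
rewrite -map_comp (nth_map 0) ?size_iota // nth_iota //= add0n.
by rewrite /rot (drop_nth x).
Qed.

Lemma sort_conjugates_lex w : primitive w ->
  sorted (@lex_lt d A) (sort lex_le (conjugates w)).
Proof.
move=> /primitive_conjugates_uniq; rewrite -(sort_uniq lex_le).
have := sort_sorted (@lex_le_total d A) (conjugates w).
elim: (sort _ _) => //= x s IH; case: s IH => //= y s IH.
move=> /andP[xy /IH{}IH] /andP[]; rewrite inE negb_or => /andP[nxy _].
by move=> /IH; move: xy; rewrite /lex_le (negbTE nxy) /= => -> ->.
Qed.

End Conjugates.

(** * Pairing the cuts of [w] and [W] *)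

Section Weave.
Context {d : Order.disp_t} {A : finOrderType d}.
Implicit Types (al w : seq A) (ps : seq (seq A)).

Lemma weave_rcons al b ps p : size ps = (size al).-1 -> al != [::] ->
  weave (rcons al b) (rcons ps p) = weave al ps ++ p ++ [:: b].
Proof.
elim: al ps => //= a [|a' al] IH [|p' ps] //= [sz] _.
by have /= -> := IH ps sz isT; rewrite -!catA.
Qed.

Lemma rev_weave al ps : size ps = (size al).-1 ->
  rev (weave al ps) = weave (rev al) (rev (map rev ps)).
Proof.
elim: al ps => [|a [|a' al] IH] [|p ps] //= [sz].
rewrite rev_cons rev_cat IH //= [rev (rev p :: _)]rev_cons [rev (a :: _)]rev_cons.
rewrite weave_rcons ?cats1 ?rcons_cat //; first by rewrite !size_rev size_map sz.
by rewrite -size_eq0 size_rev.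
Qed.

Lemma size_special_W al ps : size ps = (size al).-1 ->
  size (special_W al ps) = size (weave al ps).
Proof.
move=> sz; rewrite /special_W -[ps in LHS](mapK revK) -rev_weave ?size_map //.
rewrite size_rev; elim: al ps sz => [|a [|a' al] IH] [|p ps] //= [sz].
by rewrite !size_cat size_rev IH.
Qed.

(* Both words run through the same factor [z] after the cuts at [q.2] and [q.1],
   then [w] continues with the larger letter [b]; before the cuts they share
   [y], preceded by [a] in [w] and by [b] in [W]. *)
Definition swapped (w W : seq A) (q : nat * nat) :=
  exists s s' t t' y z a b, [/\ (a < b)%O, w = s ++ a :: y ++ z ++ b :: t,
    W = t' ++ b :: y ++ z ++ a :: s', q.1 = size (t' ++ b :: y) &
    q.2 = size (s ++ a :: y)].

(** A new first factor shifts the old cuts of [w] by [(size p).+1] and leaves those of [W] in place.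
    The cuts at 0 stay unpaired. *)
Lemma weave_matching al ps : al != [::] -> size ps = (size al).-1 ->
  sorted (fun a b : A => a < b)%O al ->
  let w := weave al ps in let W := special_W al ps in
  exists P, [/\ perm_eq (unzip1 P) (iota 1 (size w).-1),
    perm_eq (unzip2 P) (iota 1 (size w).-1) &
    forall q, q \in P -> swapped w W q].
Proof.
elim: al ps => // a [|b al] IH [|p ps] //= _; first by exists [::].
move=> [sz] /andP[ab sb].
have [//|//|//|P] := IH ps; rewrite -!/(weave (b :: al) ps).
have := size_special_W (_ : size ps = (size (b :: al)).-1); move=> /(_ sz).
have EW : special_W (a :: b :: al) (p :: ps) = special_W (b :: al) ps ++ p ++ [:: a].
  rewrite /special_W [rev (a :: _)]rev_cons [rev (p :: _)]rev_cons weave_rcons //.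
    by rewrite !size_rev.
  by rewrite -size_eq0 size_rev.
have [t et] : exists t, weave (b :: al) ps = b :: t.
  by case: (ps); [exists [::]|move=> p' ps'; exists (p' ++ weave al ps')].
have [t' et'] : exists t', special_W (b :: al) ps = rcons t' b.
  exists (rev (behead (weave (b :: al) (map rev ps)))).
  rewrite /special_W -[ps in LHS](mapK revK) -rev_weave ?size_map //.
  rewrite -rev_cons; congr rev.
  by case: (ps).
rewrite EW; set w := weave (b :: al) ps; set W := special_W (b :: al) ps.
move=> sW [p1 p2 sP].
(* The new pairs cut after [i] letters of [p], preceded by [a] in one word and by the final [b] of
   [W] in the other. *)
pose P' := [seq (size W + i, i.+1) | i <- iota 0 (size p).+1] ++
           [seq (q.1, q.2 + (size p).+1) | q <- P].
have w0 : 0 < size w by rewrite /w et.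
exists P'; split.
- rewrite /unzip1 /P' map_cat -!map_comp.
  have -> : map (fst \o (fun q => (q.1, q.2 + (size p).+1))) P = unzip1 P by [].
  have -> : size (p ++ w) = (size w).-1 + (size p).+1 by rewrite size_cat; lia.
  rewrite iotaD add1n prednK // perm_catC perm_cat // -sW.
  by rewrite -[in iota (size W) _](addn0 (size W)) iotaDl.
- rewrite /unzip2 /P' map_cat -!map_comp.
  rewrite size_cat.
  have -> : (size p + size w) = (size p).+1 + (size w).-1 by lia.
  rewrite iotaD add1n.
  apply: perm_cat.
    by rewrite -[iota 1 _]/(iota (1 + 0) _) iotaDl.
  have -> : map (snd \o (fun q => (q.1, q.2 + (size p).+1))) P =
      map (addn (size p).+1) (unzip2 P).
    by rewrite -map_comp; apply: eq_map => q /=; rewrite addnC.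
  by rewrite -[(size p).+2]addn1 iotaDl perm_map.
- move=> q; rewrite mem_cat => /orP[] /mapP[].
    move=> i; rewrite mem_iota add0n ltnS => /andP[_ ip] ->.
    exists [::], [::], t, t', (take i p), (drop i p), a, b; split=> //=.
    + by rewrite catA cat_take_drop /w et.
    + by rewrite /W et' cat_rcons catA cat_take_drop.
    + by rewrite /W et' size_cat size_rcons /= size_takel //; lia.
    + by rewrite size_takel.
  move=> q' /sP[s [s' [r [r' [y [z [a' [b' [ab' ew eW e1 e2]]]]]]]]] ->.
  exists (a :: p ++ s), (s' ++ p ++ [:: a]), r, r', y, z, a', b'; split=> //=.
  + by rewrite ew -catA.
  + by rewrite eW -!catA /= -!catA.
  + by rewrite e2 !size_cat /=; lia.
Qed.

End Weave.

(** * Special factorizations, conjugacy and clustering *)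

Section SpecialFactorizations.
Context {d : Order.disp_t} {A : finOrderType d}.
Implicit Types (al w : seq A) (ps : seq (seq A)).

Lemma swapped_rot (w W : seq A) q x : size w = size W -> swapped w W q ->
  lex_lt (rot q.1 W) (rot q.2 w) /\
  (last x (rot q.2 w) <= last x (rot q.1 W))%O.
Proof.
move=> sz [s [s' [t [t' [y [z [a [b [ab ew eW -> ->]]]]]]]]].
have -> : rot (size (s ++ a :: y)) w = z ++ b :: t ++ s ++ a :: y.
  by rewrite ew -cat_cons catA rot_size_cat -!catA.
have -> : rot (size (t' ++ b :: y)) W = z ++ a :: s' ++ t' ++ b :: y.
  by rewrite eW -cat_cons catA rot_size_cat -!catA.
split; first by rewrite lex_lt_cat2l /= ab.
rewrite !(last_cat, last_cons) /=.
(* The last letters differ only for empty [y]; they are then [a] and [b]. *)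
by case: y {ew eW} => [|c y] //=; apply: ltW.
Qed.

Lemma conjugates_cons w : w != [::] ->
  conjugates w = w :: [seq rot i w | i <- iota 1 (size w).-1].
Proof. by rewrite /conjugates; case: w => //= x s _; rewrite rot0. Qed.

Lemma conjugates_rot t w : t <= size w ->
  perm_eq (conjugates (rot t w)) (conjugates w).
Proof.
have rot1E (v : seq A) : perm_eq (conjugates (rot 1 v)) (conjugates v).
  case: v => [|x s] //; set v := x :: s.
  have -> : conjugates (rot 1 v) = rcons [seq rot i v | i <- iota 1 (size s)] v.
    rewrite /conjugates size_rot -[size v]/(size s).+1 -[(size s).+1]addn1.
    rewrite iotaD map_cat -cats1; congr (_ ++ [:: _]); last first.
      by rewrite add0n -rotD ?addn1 //; exact: (rot_size v).
    rewrite -[iota 1 _]/(iota (1 + 0) _) iotaDl -map_comp; apply/eq_in_map => i.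
    rewrite mem_iota add0n => /= hi.
    by rewrite -rotD ?addn1 ?add1n // ltnS ltnW.
  by rewrite perm_rcons /conjugates /= rot0.
elim: t => [|t IH] h; first by rewrite rot0.
by rewrite rotS // (permPl (rot1E _)) IH // ltnW.
Qed.

Lemma special_conjugate_clustering w al ps : primitive w ->
  special_factorization w al ps -> conjugate w (special_W al ps) ->
  perfectly_clustering w /\ lyndon w.
Proof.
move=> pw [sal _ sz ew] [u [v [ewuv eW]]].
have wn0 : w != [::] by case: pw.
have al0 : al != [::] by apply: contraNneq wn0 => al0; rewrite ew al0.
have {v eW ewuv} [t tw eW] : exists2 t, t <= size w & special_W al ps = rot t w.
  by exists (size u); rewrite ewuv ?size_cat ?leq_addr // rot_size_cat.
have sW := size_special_W sz; rewrite -ew in sW.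
have [P []] := weave_matching al0 sz sal; rewrite -ew => p1 p2 sP.
have Wn0 : special_W al ps != [::] by rewrite -size_eq0 sW size_eq0.
have [x [s exs]] : exists x s, w = x :: s.
  by case: (w) wn0 => // x s _; exists x, s.
pose L := sort lex_le (conjugates w).
have sL : sorted (@lex_lt d A) L by exact: sort_conjugates_lex.
have pL : perm_eq L (conjugates w) by rewrite perm_sort.
(* [special_W al ps], itself a conjugate of [w], is the missing smaller member and [w] the missing
   larger one. *)
have [|||sr hL] := @sorted_matching _ _ (fun u v => last x v <= last x u)%O L
  (special_W al ps) w [seq (rot q.1 (special_W al ps), rot q.2 w) | q <- P]
  lex_ltxx lex_lt_trans sL.
- rewrite perm_sym (permPl pL) -(permPl (conjugates_rot tw)) -eW conjugates_cons //.
  by rewrite perm_cons /unzip1 -map_comp perm_sym sW (map_comp (rot^~ _) fst) perm_map.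
- rewrite perm_sym (permPl pL) conjugates_cons //.
  by rewrite perm_cons /unzip2 -map_comp perm_sym (map_comp (rot^~ _) snd) perm_map.
- apply/allP => _ /mapP[q /sP hq ->] /=; apply/andP.
  exact: swapped_rot hq.
split; split=> //.
  by rewrite exs /= -exs sorted_map.
move=> i /andP[i0 iw].
case: (L) sL pL hL => [|y L'] /=.
  by move=> _ /perm_size /=; rewrite size_conjugates exs.
move=> pth pL yw; move: pth pL; rewrite {}yw (path_sortedE lex_lt_trans).
move=> /andP[/allP wL _]; rewrite conjugates_cons // perm_cons => /perm_mem pL.
by apply: wL; rewrite pL; apply: map_f; rewrite mem_iota; lia.
Qed.

Lemma palindromic_special_conjugate w al ps p q :
  palindrome p -> palindrome q -> w = p ++ q ->
  special_factorization w al ps -> (forall p, p \in ps -> palindrome p) ->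
  conjugate w (special_W al ps).
Proof.
move=> pp pq ewpq [_ _ sz ew] pps; exists p, q; split=> //.
rewrite /special_W; have eps : map rev ps = ps.
  by rewrite -[RHS]map_id; apply/eq_in_map => r /pps.
by rewrite -{1}eps -rev_weave // -ew ewpq rev_cat pp pq.
Qed.

End SpecialFactorizations.

(** * Discrete interval exchanges reversing the order of the intervals *)

Section SymmetricIntervalExchange.
Context {d : Order.disp_t} {A : finOrderType d} (n : nat).
Context (x : 'I_n.+1 -> A) (T : 'I_n.+1 -> 'I_n.+1).
(* Ranks of sorted conjugates, with [x] their first letter and [T] the shift:
   [x_rev] says that last letters are in the opposite order of first letters. *)
Hypothesis x_mono : forall i j : 'I_n.+1, i <= j -> (x i <= x j)%O.
Hypothesis T_mono : forall i j : 'I_n.+1, x i = x j -> i < j -> T i < T j.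
Hypothesis T_inj : injective T.
Hypothesis x_rev : forall i, x (rev_ord (T i)) = x i.
Hypothesis T_conn : forall i, fconnect T ord0 i.

Implicit Types i j f : 'I_n.+1.

Let S i := rev_ord (T i).

Lemma ord_rev_val i : rev_ord i = n - i :> nat.
Proof. by []. Qed.

Lemma flip_inj : injective S.
Proof. by move=> i j /rev_ord_inj/T_inj. Qed.

Lemma flip_decr i j : x i = x j -> i < j -> S j < S i.
Proof.
move=> xij ij; have := T_mono xij ij; rewrite /S !ord_rev_val.
by have := ltn_ord (T j); have := ltn_ord (T i); lia.
Qed.

(* [S \o S] is an increasing bijection of each finite class [x = a], hence the
   identity. *)
Lemma flipK : involutive S.
Proof.
pose g i := S (S i).
have xg i : x (g i) = x i by rewrite /g /S !x_rev.
have g_incr i j : x i = x j -> i < j -> g i < g j.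
  by move=> xij ij; apply: flip_decr; [rewrite /S !x_rev | exact: flip_decr].
have g_inj : injective g by move=> i j /flip_inj/flip_inj.
suff gid k i : i < k -> g i = i by move=> i; apply: (gid n.+1).
elim: k i => // k IH i; rewrite ltnS leq_eqVlt => /orP[/eqP ik|/IH //].
rewrite -ik in IH; apply/val_inj/eqP; case: (ltngtP (g i) i) => // gi.
  by have /g_inj e := IH _ gi; rewrite e ltnn in gi.
have [j ej] : exists j, g j = i by exists (invF g_inj i); rewrite f_invF.
have xj : x j = x i by rewrite -ej xg.
case: (ltngtP j i) => ji.
- by move: ej; rewrite (IH _ ji) => e; rewrite e ltnn in ji.
- by have := g_incr _ _ (esym xj) ji; rewrite ej; have := gi; lia.
- by move: gi; rewrite -(val_inj ji) ej (val_inj ji) ltnn.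
Qed.

Lemma exchange_rev i : T (rev_ord (T i)) = rev_ord i.
Proof. by apply: rev_ord_inj; rewrite rev_ordK; exact: flipK. Qed.

Lemma iter_exchange_rev m i :
  iter m T (rev_ord (iter m T i)) = rev_ord i.
Proof. by elim: m => //= m IH; rewrite -iterS iterSr exchange_rev. Qed.

(* [prd ord0 = ord0], hence [ord0] is not a cut. *)
Let prd i : 'I_n.+1 := inord i.-1.
Let cut i := x (prd i) != x i.
Let start i := cut i || (i == ord0).

Lemma prd_val i : prd i = i.-1 :> nat.
Proof. by rewrite inordK //; have := ltn_ord i; lia. Qed.

Lemma cut_gt0 i : cut i -> 0 < i.
Proof.
rewrite lt0n; apply: contraNneq => i0.
by rewrite (_ : prd i = i) //; apply: ord_inj; rewrite prd_val i0.
Qed.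

Lemma startN i : ~~ start i = (x (prd i) == x i) && (0 < i).
Proof. by rewrite negb_or negbK lt0n -val_eqE. Qed.

Lemma cut_lt i : cut i -> (x (prd i) < x i)%O.
Proof. by move=> ci; rewrite lt_neqAle -/(cut i) ci x_mono // prd_val; lia. Qed.

Lemma rev_prd i : 0 < i -> prd (rev_ord (prd i)) = rev_ord i /\ 0 < rev_ord (prd i).
Proof.
move=> i0; split; last by rewrite ord_rev_val prd_val; have := ltn_ord i; lia.
by apply: ord_inj; rewrite prd_val !ord_rev_val prd_val; have := ltn_ord i; lia.
Qed.

(** A rank [k] strictly between [S i] and [S (prd i)] would have the letter of [i], and [S k] would
    lie strictly between the neighbours [prd i] and [i]. *)
Lemma exchange_prd i : 0 < i -> ~~ cut i -> T (prd i) = prd (T i) /\ 0 < T i.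
Proof.
rewrite negbK => i0 /eqP xi.
have pi : prd i < i by rewrite prd_val; lia.
have ti := T_mono xi pi; have si := flip_decr xi pi.
split; last by lia.
apply: ord_inj; rewrite prd_val; apply/eqP; case: eqP => // ne.
have ltk : (S i).+1 < n.+1 by have := ltn_ord (S (prd i)); lia.
pose k := Ordinal ltk.
have nT : T (prd i) < (T i).-1 by lia.
have ks : k < S (prd i).
  by rewrite -[nat_of_ord k]/(S i).+1 /S !ord_rev_val; have := ltn_ord (T i); lia.
have xk : x k = x i.
  apply/eqP; rewrite eq_le; apply/andP; split.
    by rewrite -xi -(x_rev (prd i)) x_mono // ltnW.
  by rewrite -(x_rev i) x_mono.
have k1 : S k < i by rewrite -[X in _ < nat_of_ord X]flipK flip_decr //= /S x_rev.
have k2 : prd i < S k by rewrite -[X in nat_of_ord X < _]flipK flip_decr //= /S x_rev xi.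
by move: k1 k2; rewrite prd_val; lia.
Qed.

Lemma iter_exchange_prd m i : 0 < i -> (forall l, l < m -> ~~ cut (iter l T i)) ->
  iter m T (prd i) = prd (iter m T i) /\ 0 < iter m T i.
Proof.
move=> i0; elim: m => // m IH ncut; have [|e p] := IH.
  by move=> l lm; apply: ncut; lia.
by rewrite !iterS e; apply: exchange_prd => //; apply: ncut.
Qed.

(** Otherwise [prd i] and [i] would stay neighbours until [i] reaches [ord0], which has none below
    it. *)
Lemma exists_cut i : 0 < i -> exists m, cut (iter m T i).
Proof.
move=> i0.
have /iter_findex E : fconnect T i ord0 by rewrite fconnect_sym.
case: (boolP [exists m : 'I_(findex T i ord0), cut (iter m T i)]).
  by case/existsP => m cm; exists m.
move=> /existsPn ncut.
have [] := @iter_exchange_prd (findex T i ord0) i i0.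
  by move=> l hl; exact: (ncut (Ordinal hl)).
by rewrite E.
Qed.

(** [prd f] ends the interval before [f], and [S] reverses that interval. *)
Lemma start_flip_prd f : cut f ->
  [/\ start (S (prd f)), x (S (prd f)) = x (prd f) & S (prd f) < f].
Proof.
move=> cf; have f0 := cut_gt0 cf; have ltf := cut_lt cf.
split; [| exact: x_rev |].
  apply: contraT; rewrite startN => /andP[/eqP xp p0].
  have lt : prd (S (prd f)) < S (prd f) by rewrite prd_val; lia.
  have := flip_decr xp lt; rewrite flipK => h.
  have : (x f <= x (S (prd (S (prd f)))))%O by apply: x_mono; move: h; rewrite prd_val; lia.
  by rewrite {1}/S x_rev xp /S x_rev leNgt ltf.
rewrite ltnNge; apply/negP => /x_mono; rewrite /S x_rev leNgt ltf //.
Qed.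

(* The word read strictly between [S (prd f)] and [f] is a palindrome: the two
   neighbours [f.-1] and [f] run backwards in parallel up to [S (prd f)], and
   reversal turns this run into itself. *)
Lemma first_start_palindrome f m : cut f ->
  iter m T (S (prd f)) = f ->
  (forall l, 0 < l < m -> ~~ start (iter l T (S (prd f)))) ->
  forall l, 0 < l < m -> x (iter l T (S (prd f))) = x (iter (m - l) T (S (prd f))).
Proof.
move=> cf Em nst l /andP[l0 lm]; set f' := S (prd f) in Em nst *.
have Tf' : T f' = rev_ord (prd f) by exact: exchange_rev.
have [pr pr0] := rev_prd (cut_gt0 cf); rewrite -Tf' in pr pr0.
have [|E _] := @iter_exchange_prd l.-1 (T f') pr0.
  move=> k kl; rewrite -iterSr; have : 0 < k.+1 < m by lia.
  by move=> /nst; rewrite negb_or => /andP[].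
have := nst l; rewrite l0 lm startN => /(_ isT)/andP[/eqP <- _].
(* [rev_ord f] moves in [l.-1] steps to the reversal of the point reached at time [(m - l).+1];
   [x_rev] turns its letter into the one read at time [m - l]. *)
rewrite -[l in prd (iter l _ _)]prednK // iterSr -E pr -{1}Em.
rewrite (_ : m = l.-1 + (m - l).+1); last by lia.
by rewrite iterD iter_exchange_rev x_rev; congr (x (iter _ _ _)); lia.
Qed.

(** The neighbours [prd i] and [i] are exchanged by the reversal or by [S]. *)
Definition fixed_boundary i := (0 < i) && ((rev_ord i == prd i) || (S i == prd i)).

(** [prd i] and [i] move in parallel to the first cut [f], in [h] steps. Reflecting this run gives
    the other half, from [S (prd f)] to [i], in [h + e] steps: [e] is 1 if the reversal exchanges
    the pair and 0 if [S] does. *)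
Lemma fixed_boundary_run i : fixed_boundary i ->
  exists f h e, [/\ cut f, e <= 1, 0 < h.*2 + e,
    iter (h + e) T (S (prd f)) = i & iter h T i = f] /\
    forall l, 0 < l < h.*2 + e -> ~~ start (iter l T (S (prd f))).
Proof.
case/andP => i0 fx; have [h ch minh] := ex_minnP (exists_cut i0).
have ncut l : l < h -> ~~ cut (iter l T i).
  by move=> lh; apply/negP => /minh; lia.
have nz l : l <= h -> iter l T (prd i) = prd (iter l T i) /\ 0 < iter l T i.
  by move=> lh; apply: iter_exchange_prd => // k kl; apply: ncut; lia.
set f := iter h T i in ch; have [ef f0] := nz h (leqnn h); rewrite -/f in ef f0.
have Tf' : T (S (prd f)) = rev_ord (prd f) by exact: exchange_rev.
have back k : k <= h -> iter k.+1 T (S (prd f)) = rev_ord (prd (iter (h - k) T i)).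
  move=> kh; rewrite iterSr Tf' -ef -[in iter h](subnKC kh) iterD.
  by rewrite iter_exchange_rev; have [-> _] := nz (h - k) (leq_subr _ _).
have nback l : 0 < l <= h -> ~~ start (iter l T (S (prd f))).
  case: l => // l lh; rewrite back 1?ltnW // startN.
  have [_ p] := nz _ (leq_subr l h).
  have [-> ->] := rev_prd p; rewrite andbT.
  have [<- _] := nz _ (leq_subr l h).
  rewrite -[h - l]prednK ?subn_gt0 // !iterS !x_rev.
  have hl : (h - l).-1 < h by lia.
  by have [-> _] := nz _ (ltnW hl); have := ncut _ hl; rewrite negbK eq_sym.
have [e [e1 he0 ee]] : exists e, [/\ e <= 1, 0 < h.*2 + e & iter (h + e) T (S (prd f)) = i].
  case/orP: fx => /eqP fx.
    exists 1; split; rewrite ?addn1 //.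
    by rewrite back // subnn /= -fx rev_ordK.
  (* [S] preserves letters, so a pair that it exchanges is not separated by a cut. *)
  have h0 : 0 < h.
    rewrite lt0n; apply/eqP => h0; move: ch.
    by rewrite /f h0 /= /cut -fx /S x_rev eqxx.
  exists 0; split; rewrite ?addn0 // ?double_gt0 //.
  rewrite -(prednK h0) back ?leq_pred // (_ : h - h.-1 = 1)%N; last by lia.
  by have [/= <- _] := nz _ h0; rewrite -[LHS]/(S (prd i)) -fx flipK.
exists f, h, e; split=> // l /andP[l0 lhe].
case: (leqP l h) => lh; first by apply: nback; rewrite l0.
have lhe' : h + e <= l by lia.
rewrite -(subnK lhe') iterD ee startN.
have hl : l - (h + e) < h by lia.
have [_ ->] := nz _ (ltnW hl); rewrite andbT.
by have := ncut _ hl; rewrite negbK.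
Qed.

(** * Counting fixed points and fixed boundaries *)

Lemma order_exchange : order T ord0 = n.+1.
Proof.
by rewrite /order (eq_card (_ : _ =i predT)) ?card_ord //.
Qed.

Lemma iter_exchange_mod k : iter k T ord0 = iter (k %% n.+1) T ord0.
Proof.
have per c : iter (c * n.+1) T ord0 = ord0.
  elim: c => // c IH; rewrite mulSn iterD IH.
  by have := iter_order T_inj ord0; rewrite order_exchange.
by rewrite {1}(divn_eq k n.+1) addnC iterD per.
Qed.

Lemma eq_iter_exchange k l : iter k T ord0 = iter l T ord0 -> k = l %[mod n.+1].
Proof.
have fk m : findex T ord0 (iter m T ord0) = m %% n.+1.
  by rewrite iter_exchange_mod findex_iter // order_exchange ltn_mod.
by move=> e; rewrite -!fk e.
Qed.

(* A fixed point [iter m T 0] of [rev_ord], resp. of [S], satisfies [2m = c],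
   resp. [2m + 1 = c], modulo [n.+1], where [rev_ord 0 = iter c T 0]. *)
Lemma card_fixed_points :
  #|[set i : 'I_n.+1 | rev_ord i == i]| + #|[set i | S i == i]| <= 2.
Proof.
set R0 := [set i : 'I_n.+1 | rev_ord i == i]; set S0 := [set i | S i == i].
pose t i := findex T ord0 i; pose c := t (rev_ord ord0).
have tK i : iter (t i) T ord0 = i by apply: iter_findex.
have t_lt i : t i < n.+1 by rewrite -order_exchange; apply: findex_max.
have t_inj : injective t by exact: can_inj tK.
have tR i : iter (t i) T (rev_ord i) = rev_ord ord0.
  by rewrite -{2}(tK i) iter_exchange_rev.
(* Parity keeps the two kinds of fixed points apart; all entries are below [n.+1.*2] and congruent
   to [c]. *)
pose s := [seq (t i).*2 | i <- enum R0] ++ [seq (t i).*2.+1 | i <- enum S0].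
have us : uniq s.
  rewrite cat_uniq !map_inj_uniq ?enum_uniq ?andbT /=; first last.
  - by move=> i j /double_inj/t_inj.
  - by move=> i j [/double_inj/t_inj].
  apply/hasPn => u /mapP[i _ ->]; apply/mapP => -[j _].
  by move/(congr1 odd); rewrite /= !odd_double.
have -> : #|R0| + #|S0| = size s by rewrite size_cat !size_map -!cardE.
apply: (@uniq_leq_size _ s [:: c; c + n.+1]) => // u us'.
have [u2 eu] : u < n.+1.*2 /\ iter u T ord0 = iter c T ord0.
  rewrite tK; move: us'; rewrite mem_cat => /orP[] /mapP[i].
    rewrite mem_enum inE => /eqP fi ->; split; first by have := t_lt i; lia.
    by rewrite -addnn iterD tK -{2}fi tR.
  rewrite mem_enum inE => /eqP fi ->; split; first by have := t_lt i; lia.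
  have := iter_exchange_rev (t i) (T ord0); rewrite -iterSr iterS tK -/(S i) fi.
  by rewrite -addnn -addSn iterD tK iterS => ->; rewrite exchange_rev.
have c_lt : c < n.+1 by exact: t_lt.
have := eq_iter_exchange eu; rewrite (modn_small c_lt) !inE => eum.
have := divn_eq u n.+1; rewrite eum.
have : u %/ n.+1 < 2 by rewrite ltn_divLR // mul2n.
by case: (u %/ n.+1) => [|[|//]] _ ->; rewrite ?mul0n ?mul1n ?eqxx // addnC eqxx orbT.
Qed.

(** This is the middle of a reversed interval: the least [i] of the class with [S i <= i]. If
    [S i < prd i], then [prd i] would satisfy the same inequality. *)
Lemma class_fixed i0 :
  exists2 i, x i = x i0 & S i = i \/ (0 < i /\ S i = prd i).
Proof.
pose P i := (x i == x i0) && (S i <= i).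
have [i1 Pi1] : exists i, P i.
  case: (leqP (S i0) i0) => h; first by exists i0; rewrite /P eqxx.
  by exists (S i0); rewrite /P flipK ltnW // /S x_rev eqxx.
case: (arg_minnP (fun i : 'I_n.+1 => nat_of_ord i) Pi1) => i /andP[/eqP xi Si] imin.
exists i => //; move: Si; rewrite leq_eqVlt => /orP[/eqP/ord_inj|ltSi]; first by left.
have i0' : 0 < i by lia.
have pi := prd_val i.
have xp : x (prd i) = x i.
  apply/eqP; rewrite eq_le x_mono ?pi ?leq_pred //=.
  by rewrite -[x i]x_rev x_mono // pi; move: ltSi; rewrite /S; lia.
right; split=> //; apply: ord_inj; apply/eqP; case: eqP => // ne.
have lt : S i < prd i by lia.
have := flip_decr (_ : x (S i) = x (prd i)) lt; rewrite flipK {1}/S x_rev xp => /(_ erefl) h.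
have : P (prd i) by rewrite /P xp xi eqxx; lia.
by move=> /imin; lia.
Qed.

Lemma start_inj i j : start i -> start j -> x i = x j -> i = j.
Proof.
wlog lt_ij : i j / i < j.
  move=> H si sj xij; case: (ltngtP i j) => [h|h|/ord_inj //]; first exact: H.
  by apply/esym/H.
move=> _ sj xij; move: sj; rewrite /start -val_eqE /= => /orP[cj|]; last by lia.
have := cut_lt cj; rewrite -xij ltNge x_mono // prd_val; lia.
Qed.

(** Each of the [k] classes meets [S0] or [S1], and [R0] or [R1] contains a middle rank. Of these
    [k + 1] at most two are fixed points, which leaves [k - 1], the number of cuts. *)
Lemma card_cuts : #|[set i | cut i]| <= #|[set i | fixed_boundary i]|.
Proof.
pose R0 := [set i : 'I_n.+1 | rev_ord i == i]; pose S0 := [set i | S i == i].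
pose R1 := [set i : 'I_n.+1 | (0 < i) && (rev_ord i == prd i)].
pose S1 := [set i : 'I_n.+1 | (0 < i) && (S i == prd i)].
have cs : #|[set i | start i]| = #|[set i | cut i]|.+1.
  rewrite (_ : [set i | start i] = ord0 |: [set i | cut i]).
    by rewrite cardsU1 inE; case: (boolP (cut ord0)) => // /cut_gt0.
  by apply/setP => i; rewrite !inE orbC.
have c1 : #|[set i | start i]| <= #|S0| + #|S1|.
  have -> : #|[set i | start i]| = #|x @: [set i | start i]|.
    by rewrite card_in_imset // => i j; rewrite !inE; apply: start_inj.
  apply: leq_trans (leq_card_setU S0 S1).
  apply: leq_trans (leq_imset_card x (S0 :|: S1)); apply: subset_leq_card.
  apply/subsetP => _ /imsetP[i _ ->]; have [j xj fj] := class_fixed i.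
  apply/imsetP; exists j => //; rewrite !inE.
  by case: fj => [->|[-> ->]]; rewrite eqxx ?orbT.
have c2 : 0 < #|R0| + #|R1|.
  have h : (n.+1)./2 < n.+1 by lia.
  have : (Ordinal h \in R0) || (Ordinal h \in R1).
    rewrite !inE -!val_eqE /= prd_val /= subSS; lia.
  by rewrite addn_gt0 => /orP[] hi; apply/orP; [left|right]; apply/card_gt0P; exists (Ordinal h).
have c3 : #|[set i | fixed_boundary i]| = #|R1| + #|S1|.
  rewrite (_ : [set i | fixed_boundary i] = R1 :|: S1); last first.
    by apply/setP => i; rewrite !inE -andb_orr.
  (* A pair exchanged by both maps would make [i] a fixed point of [T], hence [ord0]. *)
  rewrite cardsU (_ : R1 :&: S1 = set0) ?cards0 ?subn0 //.
  apply/setP => i; rewrite !inE; apply/negP => /andP[/andP[i0 /eqP ri] /andP[_ /eqP si]].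
  have Ti : T i = i by apply: rev_ord_inj; rewrite ri -si.
  have /iter_findex : fconnect T i ord0 by rewrite fconnect_sym.
  rewrite (_ : iter _ T i = i); last by elim: (findex _ _ _) => //= m ->.
  by move=> ei; rewrite ei in i0.
have := card_fixed_points; rewrite -/R0 -/S0 c3; lia.
Qed.

(** * First points of the intervals along the orbit of 0 *)

Definition first_start_after (f' f : 'I_n.+1) m :=
  [/\ 0 < m, iter m T f' = f & forall l, 0 < l < m -> ~~ start (iter l T f')].

Lemma first_start_uniq f' f m m' : start f ->
  first_start_after f' f m -> first_start_after f' f m' -> m = m'.
Proof.
move=> sf; wlog lt_mm : m m' / m < m'.
  move=> H h h'; case: (ltngtP m m') => // lt; first exact: H.
  by apply/esym/H.
move=> [m0 em _] [_ _ /(_ m)].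
by rewrite m0 lt_mm em sf => /(_ isT).
Qed.

(* The fixed boundaries run to pairwise distinct cuts, and there are enough of
   them to reach every cut. *)
Lemma cut_first_start f : cut f -> exists m, first_start_after (S (prd f)) f m.
Proof.
(* The conditional form allows a total choice function [g], arbitrary outside the fixed
   boundaries. *)
pose P i f := fixed_boundary i -> exists h e, [/\ cut f, e <= 1,
  iter (h + e) T (S (prd f)) = i & first_start_after (S (prd f)) f (h.*2 + e)].
have [i|g gP] := @fin_all_exists _ _ P.
  case: (boolP (fixed_boundary i)) => [|nf]; last by exists i => /(negP nf).
  case/fixed_boundary_run => f0 [h [e [[cf e1 he ei ef] nst]]].
  exists f0 => _; exists h, e; split=> //; split=> //.
  by rewrite -addnn -addnA iterD ei.
have g_inj : {in [set i | fixed_boundary i] &, injective g}.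
  move=> i j; rewrite !inE => /gP[h [e [ci e1 ei fi]]] /gP[k [e' [cj e1' ej fj]]] gij.
  rewrite -gij in ej fj; have := first_start_uniq _ fi fj.
  (* As [e <= 1], the length [h.*2 + e] determines the position [h + e] of the boundary. *)
  rewrite /start ci => /(_ isT) he; rewrite -ei -ej; congr iter; lia.
move=> cf; suff : f \in g @: [set i | fixed_boundary i].
  by case/imsetP => i; rewrite inE => /gP[h [e [_ _ _ fi]]] ->; exists (h.*2 + e).
have sub : g @: [set i | fixed_boundary i] \subset [set i | cut i].
  apply/subsetP => _ /imsetP[i fi ->]; move: fi.
  by rewrite !inE => /gP[h [e [ci _ _ _]]].
have /eqP -> : g @: [set i | fixed_boundary i] == [set i | cut i].
  by rewrite eqEcard sub card_in_imset // card_cuts.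
by rewrite inE.
Qed.

Let traj m := [seq x (iter l T ord0) | l <- iota 0 m].

(** By strong induction, the prefix for the preceding start [S (prd f)] is extended by the
    palindromic segment up to [f]. Not returning to [ord0] is recorded to bound [m] by the period at
    the last start. *)
Lemma special_prefix f : start f -> exists al ps m,
  [/\ iter m T ord0 = f, forall l, 0 < l <= m -> iter l T ord0 != ord0 &
      weave (rcons al (x f)) ps = traj m.+1] /\
  [/\ size ps = size al, sorted (fun a b : A => (a < b)%O) (rcons al (x f)),
      forall a, (a \in rcons al (x f)) = [exists i : 'I_n.+1, (i <= f) && (x i == a)] &
      forall p, p \in ps -> palindrome p].
Proof.
have [k] := ubnP (nat_of_ord f); elim: k f => // k IH f; rewrite ltnS => fk.
move=> sf; case: (boolP (cut f)) => [cf|ncf]; last first.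
  move: sf; rewrite /start (negbTE ncf) => /eqP -> {f fk ncf}.
  exists [::], [::], 0; split; split=> //; first by case=> [|l]; rewrite ?ltn0 ?andbF.
  move=> a; rewrite inE; apply/eqP/existsP => [->|[i]].
    by exists ord0; rewrite leqnn eqxx.
  rewrite leqn0 => /andP[/eqP i0 /eqP <-]; congr x; exact: ord_inj.
have [sf' xf' ltf'] := start_flip_prd cf; set f' := S (prd f) in sf' xf' ltf'.
have [|al [ps [m [[em nz ew] [sz sal memal pal]]]]] := IH f' _ sf'; first by lia.
have [q fq] := cut_first_start cf; have [q0 eq nst] := fq.
pose p := [seq x (iter l T f') | l <- iota 1 q.-1].
exists (rcons al (x f')), (rcons ps p), (m + q); split; split.
- by rewrite addnC iterD em.
- move=> l /andP[l0 lmq]; case: (leqP l m) => lm; first by rewrite nz ?l0.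
  rewrite -(subnK (ltnW lm)) iterD em.
  case: (ltngtP (l - m) q) => lq; last 1 first.
  + rewrite lq eq; apply: contraTneq cf => ->.
    by apply/negP => /cut_gt0.
  + have := nst (l - m); rewrite -/f' lq subn_gt0 lm => /(_ isT).
    by rewrite negb_or => /andP[].
  + by lia.
- rewrite weave_rcons ?size_rcons //; last by rewrite -size_eq0 size_rcons.
  rewrite ew /traj -addSn iotaD map_cat; congr (_ ++ _).
  have sh l : iter (m + l) T ord0 = iter l T f' by rewrite addnC iterD em.
  rewrite add0n -[m.+1]addn1 iotaDl -map_comp.
  rewrite (_ : iota 1 q = iota 1 (q.-1 + 1)); last by rewrite addn1 prednK.
  rewrite iotaD map_cat; congr (_ ++ [:: _]).
    by apply: eq_map => l /=; rewrite sh.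
  by rewrite /= sh add1n prednK // eq.
- by rewrite !size_rcons sz.
- have lt : (x f' < x f)%O by rewrite xf' cut_lt.
  case: (al) sal => [|b s] /= sal; first by rewrite lt.
  by rewrite rcons_path sal last_rcons.
- move=> a; rewrite mem_rcons inE memal; apply/orP/existsP.
    case=> [/eqP ->|/existsP[i /andP[lei xi]]]; first by exists f; rewrite leqnn eqxx.
    by exists i; rewrite xi andbT; lia.
  case=> i /andP[lei /eqP xi]; case: (ltngtP i f) => [ltif|gtif|/ord_inj eif].
  + right; apply/existsP; case: (leqP i f') => h; first by exists i; rewrite h xi eqxx.
    exists f'; rewrite leqnn -xi eq_le x_mono ?(ltnW h) //= xf' x_mono // prd_val; lia.
  + by lia.
  + by left; rewrite -xi eif.
- move=> r; rewrite mem_rcons inE => /orP[/eqP ->|/pal //]; rewrite /palindrome.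
  have sp : size p = q.-1 by rewrite size_map size_iota.
  apply: (@eq_from_nth _ (x f)); rewrite size_rev sp // => i hi.
  rewrite nth_rev ?sp // !(nth_map 0) ?size_iota ?nth_iota //; try lia.
  have hq : 0 < 1 + i < q by lia.
  rewrite (first_start_palindrome cf eq nst hq) -/f'.
  by have -> : q - (1 + i) = 1 + (q.-1 - i.+1) by lia.
Qed.

Lemma special_trajectory : exists al ps,
  [/\ sorted (fun a b : A => (a < b)%O) al, forall a, (a \in al) = (a \in codom x),
      size ps = (size al).-1, weave al ps = traj n.+1 &
      forall p, p \in ps -> palindrome p].
Proof.
(* The first point of the last interval; as [T f = ord0], it also ends the orbit. *)
pose f := S (rev_ord ord0).
have Sf : S f = rev_ord ord0 by exact: flipK.
have Tf : T f = ord0 by apply: rev_ord_inj.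
have sf : start f.
  apply: contraT; rewrite startN => /andP[/eqP xp f0].
  have lt : prd f < f by rewrite prd_val; lia.
  have := flip_decr xp lt; rewrite Sf ord_rev_val subn0.
  by have := ltn_ord (S (prd f)); lia.
have [al [ps [m [[em nz ew] [sz sal memal pal]]]]] := special_prefix sf.
exists (rcons al (x f)), ps; split=> //.
- move=> a; rewrite memal; apply/existsP/codomP => [[i /andP[_ /eqP <-]]|[i ->]].
    by exists i.
  case: (leqP i f) => h; first by exists i; rewrite h eqxx.
  exists f; rewrite leqnn eq_le x_mono ?(ltnW h) //= /f /S x_rev x_mono //.
  by rewrite ord_rev_val subn0 -ltnS.
- by rewrite size_rcons.
- rewrite ew; congr traj.
  (* [m.+1] is a multiple of [n.+1]; a larger one than [n.+1] itself would force an earlier return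
     to [ord0]. *)
  have := @eq_iter_exchange m.+1 0; rewrite iterS em => /(_ Tf).
  rewrite mod0n => /eqP /dvdnP[[|[|c]] E]; rewrite ?mul1n // in E.
  have le_nm : 0 < n.+1 <= m by nia.
  by have := nz _ le_nm; rewrite iter_exchange_mod modnn eqxx.
Qed.

Lemma rot_trajectory c : c <= n.+1 ->
  rot c (traj n.+1) = [seq x (iter l T ord0) | l <- iota c n.+1].
Proof.
move=> cn; rewrite /rot -map_drop -map_take -map_cat.
rewrite drop_iota take_iota (minn_idPl cn) add0n.
have := iotaD c (n.+1 - c) c; rewrite subnK // subnKC // => ->.
rewrite !map_cat; congr (_ ++ _).
have -> : iota n.+1 c = map (addn n.+1) (iota 0 c) by rewrite -iotaDl addn0.
rewrite -map_comp; apply: eq_map => l.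
rewrite -[RHS]/(x (iter (n.+1 + l) T ord0)).
by rewrite iter_exchange_mod [in RHS]iter_exchange_mod modnDl.
Qed.

(** The reversal of ranks runs the orbit of [ord0] backwards from [rev_ord ord0], which is reached
    at time [c]. *)
Lemma rev_trajectory : exists2 c, c <= n.+1 &
  rev (traj n.+1) = rot c (traj n.+1).
Proof.
pose c := findex T ord0 (rev_ord ord0).
have cn : c < n.+1 by rewrite -order_exchange findex_max.
have Ec : iter c T ord0 = rev_ord ord0 by apply: iter_findex.
exists c; [exact: ltnW | rewrite rot_trajectory; last exact: ltnW].
apply: (@eq_from_nth _ (x ord0)); rewrite size_rev !size_map !size_iota // => i hi.
rewrite nth_rev size_map size_iota // !(nth_map 0) ?size_iota ?nth_iota //; try lia.
have E0 : iter n.+1 T ord0 = ord0 by rewrite iter_exchange_mod modnn.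
have e : iter i T (iter (n - i).+1 T ord0) = ord0.
  by rewrite -iterD (_ : i + (n - i).+1 = n.+1) //; lia.
by rewrite add0n subSS addnC iterD Ec -{2}e iter_exchange_rev iterS x_rev.
Qed.

End SymmetricIntervalExchange.

(** * The interval exchange of a clustering Lyndon word *)

Section ClusteringExchange.
Context {d : Order.disp_t} {A : finOrderType d}.
Implicit Types (w : seq A).

(** The shift [T] acts on the ranks in the sorted list [L]. The Lyndon property gives [w] rank 0,
    primitivity makes ranks unambiguous, and clustering yields [x_rev]. *)
Lemma clustering_lyndon_palindromic w : perfectly_clustering w -> lyndon w ->
  (exists p q, [/\ palindrome p, palindrome q & w = p ++ q]) /\
  exists al ps, special_factorization w al ps /\ forall p, p \in ps -> palindrome p.
Proof.
move=> [pw bw_sorted] [_ lw].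
have [x0 [s ew]] : exists x0 s, w = x0 :: s.
  by case: (w) pw => [|x0 s] []// _ _; exists x0, s.
pose n := size s; have sw : size w = n.+1 by rewrite ew.
pose L := sort lex_le (conjugates w).
have pL : perm_eq L (conjugates w) by rewrite perm_sort.
have sL : size L = n.+1 by rewrite size_sort size_conjugates.
have uL : uniq L by rewrite sort_uniq primitive_conjugates_uniq.
have ltL : sorted (@lex_lt d A) L by exact: sort_conjugates_lex.
pose u (i : 'I_n.+1) := nth [::] L i.
have u_inL i : u i \in L by rewrite mem_nth ?sL.
have memL v : v \in L -> exists2 k, k < n.+1 & v = rot k w.
  rewrite (perm_mem pL) => /mapP[k]; rewrite mem_iota sw => kn ->.
  by exists k.
have rotL k : k < n.+1 -> rot k w \in L.
  by move=> kn; rewrite (perm_mem pL); apply/mapP; exists k; rewrite ?mem_iota ?sw.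
have u_size i : size (u i) = n.+1.
  by have [k _ ->] := memL _ (u_inL i); rewrite size_rot.
have u_inj : injective u.
  by move=> i j /eqP; rewrite nth_uniq ?sL // => /eqP/ord_inj.
have u_lt (i j : 'I_n.+1) : i < j -> lex_lt (u i) (u j).
  by move=> ij; apply: (sorted_ltn_nth lex_lt_trans); rewrite ?inE ?sL.
have ltu (i j : 'I_n.+1) : lex_lt (u i) (u j) -> i < j.
  move=> lij; rewrite ltnNge leq_eqVlt; apply/negP => /orP[/eqP/ord_inj eij|/u_lt lji].
    by move: lij; rewrite eij lex_ltxx.
  by have := lex_lt_trans lij lji; rewrite lex_ltxx.
have u_onto v : v \in L -> exists i, u i = v.
  move=> vL; have iv : index v L < n.+1 by rewrite -sL index_mem.
  by exists (Ordinal iv); rewrite /u nth_index.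
pose x i := head x0 (u i).
pose T (i : 'I_n.+1) : 'I_n.+1 := inord (index (rot 1 (u i)) L).
have uT i : u (T i) = rot 1 (u i).
  have rL : rot 1 (u i) \in L.
    have [k kn ->] := memL _ (u_inL i); rewrite -rotS ?sw //.
    move: kn; rewrite leq_eqVlt => /orP[/eqP[->]|/rotL //].
    by rewrite -sw rot_size -[w]rot0 rotL.
  by rewrite /u inordK ?nth_index // -sL index_mem.
have u_cons i : exists v, u i = x i :: v.
  rewrite /x; case: (u i) (u_size i) => // a v _; by exists v.
have uT_iter m i : u (iter m T i) = iter m (rot 1) (u i).
  by elim: m => //= m IH; rewrite uT IH.
have u0 : u ord0 = w.
  have [i ui] : exists i, u i = w by apply: u_onto; rewrite -[w]rot0 rotL.
  rewrite -ui; congr u; apply: ord_inj; apply/eqP; case: eqP => // /eqP i0.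
  have lt0 : lex_lt (u ord0) w by rewrite -ui u_lt //= lt0n eq_sym.
  have [[|k] kn e] := memL _ (u_inL ord0).
    by move: lt0; rewrite e rot0 lex_ltxx.
  have := lex_lt_trans lt0 (lw k.+1 _); rewrite -e lex_ltxx sw kn => h.
  exact: h.
have uTw m : m <= n.+1 -> u (iter m T ord0) = rot m w.
  by move=> mn; rewrite uT_iter u0 rot_iter_rot1 ?sw.
have x_mono (i j : 'I_n.+1) : i <= j -> (x i <= x j)%O.
  rewrite leq_eqVlt => /orP[/eqP/ord_inj -> //|/u_lt].
  have [v ->] := u_cons i; have [v' ->] := u_cons j.
  by move=> /= /orP[/ltW //|/andP[/eqP-> _]].
have T_mono (i j : 'I_n.+1) : x i = x j -> i < j -> T i < T j.
  move=> xij /u_lt lij; apply: ltu; rewrite !uT; move: lij (u_size i) (u_size j).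
  have [v ->] := u_cons i; have [v' ->] := u_cons j; rewrite xij.
  by move=> lij [sv] [sv']; apply: lex_lt_rot1; rewrite ?sv ?sv'.
have T_inj : injective T.
  by move=> i j /(congr1 u); rewrite !uT => /rot_inj/u_inj.
have T_conn i : fconnect T ord0 i.
  have [k kn ui] := memL _ (u_inL i).
  by rewrite -(u_inj (iter k T ord0) i) ?fconnect_iter // uTw ?ui // ltnW.
have bwE : bw w = map (last x0) L by rewrite /L ew.
(* Both sides are the weakly increasing arrangement of the letters of [w]. *)
have heads : rev (bw w) = map (head x0) L.
  apply: (@sorted_eq _ (<=%O)); [exact: le_trans | exact: le_anti | | |].
  - by rewrite rev_sorted.
  - rewrite sorted_map; apply: (sub_in_sorted (P := [pred v | size v == n.+1])) ltL.
      move=> [|a v] [|b v'] //= _ _ /orP[/ltW //|/andP[/eqP-> _]]; exact: lexx.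
    by apply/allP => v /u_onto[i <-]; rewrite inE u_size.
  - rewrite perm_rev bwE.
    apply: perm_trans (_ : perm_eq w _).
      apply: perm_trans (map_last_conjugates x0 w); exact: perm_map.
    by rewrite perm_sym -[X in perm_eq _ X](map_head_conjugates x0) perm_map.
(* The last letter of [u (T i)] is [x i]; by [heads] it is also the first letter at the mirrored
   rank. *)
have x_rev i : x (rev_ord (T i)) = x i.
  have [v ui] := u_cons i.
  transitivity (nth x0 (map (head x0) L) (rev_ord (T i))).
    by rewrite (nth_map [::]) ?sL.
  rewrite -heads nth_rev ?bwE ?size_map ?sL // (nth_map [::]) ?sL ?subSS ?ltnS ?leq_subr //.
  rewrite subKn; last by rewrite -ltnS.
  by rewrite -/(u (T i)) uT ui rot1_cons last_rcons.
have trajE : [seq x (iter l T ord0) | l <- iota 0 n.+1] = w.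
  rewrite -[RHS](map_head_conjugates x0) -map_comp sw; apply/eq_in_map => l.
  by rewrite mem_iota /= => ln; rewrite /x uTw // ltnW.
split.
  have [c cn] := rev_trajectory T_mono T_inj x_rev T_conn; rewrite trajE => rw.
  exists (take c w), (drop c w); rewrite cat_take_drop.
  (* Comparing pieces of equal length in [rev w = rot c w] makes both parts of the cut at [c]
     palindromes. *)
  have : rev (take c w ++ drop c w) = drop c w ++ take c w by rewrite cat_take_drop rw.
  rewrite rev_cat => /eqP; rewrite eqseq_cat ?size_rev // => /andP[/eqP ? /eqP ?].
  by split.
have [al [ps [sal memal sz ews pal]]] := special_trajectory x_mono T_mono T_inj x_rev T_conn.
exists al, ps; split=> //; split=> //; last by rewrite ews trajE.
move=> a; rewrite memal; apply/codomP/idP => [[i ->]|].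
  have [k _ ui] := memL _ (u_inL i); rewrite -(mem_rot k) -ui.
  by have [v ->] := u_cons i; rewrite mem_head.
by rewrite -{1}trajE => /mapP[l _ ->]; exists (iter l T ord0).
Qed.

End ClusteringExchange.

Theorem theorem3p1 (d : Order.disp_t) (A : finOrderType d) (w : seq A) :
  primitive w ->
  ((perfectly_clustering w /\ lyndon w) <->
   ((exists p q : seq A, [/\ palindrome p, palindrome q & w = p ++ q]) /\
    (exists (al : seq A) (ps : seq (seq A)),
        special_factorization w al ps /\ (forall p, p \in ps -> palindrome p))))
  /\
  (((exists p q : seq A, [/\ palindrome p, palindrome q & w = p ++ q]) /\
    (exists (al : seq A) (ps : seq (seq A)),
        special_factorization w al ps /\ (forall p, p \in ps -> palindrome p)))
   <->
   (exists (al : seq A) (ps : seq (seq A)),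
        special_factorization w al ps /\ conjugate w (special_W al ps))).
Proof.
move=> pw.
have i_ii : perfectly_clustering w /\ lyndon w ->
    (exists p q : seq A, [/\ palindrome p, palindrome q & w = p ++ q]) /\
    exists al ps, special_factorization w al ps /\ forall p, p \in ps -> palindrome p.
  by case; apply: clustering_lyndon_palindromic.
have ii_iii : (exists p q : seq A, [/\ palindrome p, palindrome q & w = p ++ q]) /\
    (exists al ps, special_factorization w al ps /\ forall p, p \in ps -> palindrome p) ->
    exists al ps, special_factorization w al ps /\ conjugate w (special_W al ps).
  move=> [[p [q [pp pq ewpq]]] [al [ps [fw pps]]]].
  exists al, ps; split=> //; exact: palindromic_special_conjugate pp pq ewpq fw pps.
have iii_i : (exists al ps, special_factorization w al ps /\ conjugate w (special_W al ps)) ->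
    perfectly_clustering w /\ lyndon w.
  by move=> [al [ps [fw cw]]]; apply: special_conjugate_clustering fw cw.
by split; split=> // h; [exact/iii_i/ii_iii | exact/i_ii/iii_i].
Qed.
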